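(* Let $A\in\mathbb{R}^{d\times d}$, $u_0\in\mathbb{R}^d$, $h>0$. Let $(u(t))_{t\ge0}$ be the solution of $u'=Au$, $u(0)=u_0$, let $(V(t),\overline{V}(t))_{t\ge0}$ be the corresponding stochastic Euler dynamics (with $f(u)=Au$) with stepsize parameter $h$ and initial value $u_0$, and let $(K(t))_{t\ge0}$ be the associated Poisson process. Then: (i) $\mathbb{E}\big[\|V(\varepsilon)-u(\varepsilon)\|^2 \,\big|\, K(\varepsilon)=k\big]^{1/2} = O(\varepsilon^2;\ \varepsilon\downarrow0)$ for every $k\in\mathbb{N}_0$; (ii) $\mathbb{E}\big[\|V(\varepsilon)-u(\varepsilon)\|^2\big]^{1/2} = O(\varepsilon^2;\ \varepsilon\downarrow0)$.
   Context: $\|\cdot\|$ is the Euclidean norm, $\mathbb{N}_0=\{0,1,2,\ldots\}$, and $O(\varepsilon^2;\varepsilon\downarrow0)$ denotes the usual Landau symbol as $\varepsilon\downarrow0$. Stochastic Euler dynamics for $f:\mathbb{R}^d\to\mathbb{R}^d$ Lipschitz: let $H_1,H_2,\ldots$ be i.i.d. exponential random variables with mean $h$ (rate $1/h$), $T_0=0$, $T_k = H_1+\cdots+H_k$. The process $(V(t),\overline{V}(t))_{t\ge0}$ is defined by $V(0)=\overline{V}(0)=u_0$; on each interval between consecutive jump times $T_{k-1},T_k$ $(k\in\mathbb{N})$ it follows $V'(t)=f(\overline{V}(t))$, $\overline{V}'(t)=0$; at each jump time $T_k$ $(k\in\mathbb{N})$, $V(T_k)=V(T_k-)$ and $\overline{V}(T_k)=V(T_k-)$,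 where $g(t-)$ denotes the left limit. Associated Poisson process: $(K(t))_{t\ge0}$ is the homogeneous Poisson process with rate $1/h$ that starts at $K(0)=0$ and is incremented by one at each of the same jump times $T_1,T_2,\ldots$; so $K(\varepsilon)=k$ iff $T_k\le\varepsilon<T_{k+1}$. *)

(* Defs.v *)
From HB Require Import structures.
From mathcomp Require Import all_boot all_order all_algebra finmap.
From mathcomp Require Import all_classical all_reals all_analysis.

Set Implicit Arguments.
Unset Strict Implicit.
Unset Printing Implicit Defensive.

Import Order.TTheory GRing.Theory Num.Theory.
Import numFieldNormedType.Exports.

Local Open Scope classical_set_scope.
Local Open Scope ring_scope.

(* The norm that MathComp-Analysis puts on matrices is the sup norm; it induces
   the same topology and derivatives, but the theorem is about this one. *)
Definition euclidean_norm (R : realType) (d : nat) (x : 'cV[R]_d) : R :=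
  Num.sqrt (\sum_(i < d) x i 0 ^+ 2).

(* y' = g on the half-line or half-open interval with endpoints a and b, with
   left endpoint a included: y is continuous up to a, so that its value at a
   acts as an initial value. *)
Definition solves_on (R : realType) (d : nat) (a : R) (b : itv_bound R)
    (y g : R -> 'cV[R]_d) : Prop :=
  {within [set` Interval (BLeft a) b], continuous y} /\
  (forall t, t \in Interval (BRight a) b -> is_derive t 1 y (g t)).

Definition mutually_independent d (T : measurableType d) (R : realType)
    (P : probability T R) (I : choiceType) (X : I -> {RV P >-> R}) : Prop :=
  forall (J : {fset I}) (B : I -> set R),
    (forall i, i \in J -> measurable (B i)) ->
    P (\bigcap_(i in [set` J]) (X i @^-1` B i)) =
    (\prod_(i <- J) P (X i @^-1` B i))%E.

Definition has_exponential_law d (T : measurableType d) (R : realType)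
    (P : probability T R) (rate : R) (X : {RV P >-> R}) : Prop :=
  forall B : set R, measurable B ->
    distribution P X B = exponential_prob rate B.

(* H 0, H 1, H 2, ... stand for H_1, H_2, H_3, ... *)
Definition jump_time (R : realType) (T : Type) (H : nat -> T -> R)
    (k : nat) (w : T) : R :=
  \sum_(i < k) H i w.

Record euler_path (R : realType) (d : nat) (f : 'cV[R]_d -> 'cV[R]_d)
    (u0 : 'cV[R]_d) (tau : nat -> R) (v vb : R -> 'cV[R]_d) : Prop := EulerPath {
  euler_path_init : v 0 = u0 /\ vb 0 = u0;
  euler_path_flow : forall k,
    solves_on (tau k) (BLeft (tau k.+1)) v (fun t => f (vb t)) /\
    solves_on (tau k) (BLeft (tau k.+1)) vb (fun=> 0);
  (* the left limit v(T_k -) exists and is the new value of both components *)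
  euler_path_jump : forall k,
    v t @[t --> (tau k.+1)^'-] --> v (tau k.+1) /\
    v t @[t --> (tau k.+1)^'-] --> vb (tau k.+1) }.

(* The path description is required almost surely: it has no meaning on the
   null event where some H_k is not positive. *)
Record stochastic_euler d (T : measurableType d) (R : realType)
    (P : probability T R) (n : nat) (f : 'cV[R]_n -> 'cV[R]_n) (h : R)
    (u0 : 'cV[R]_n) (H : nat -> {RV P >-> R}) (V Vb : R -> T -> 'cV[R]_n) :
    Prop := StochasticEuler {
  stochastic_euler_indep : mutually_independent H;
  stochastic_euler_exp : forall k, has_exponential_law h^-1 (H k);
  stochastic_euler_meas : forall (t : R) (i : 'I_n), 0 <= t ->
    measurable_fun setT (fun w => V t w i 0) /\
    measurable_fun setT (fun w => Vb t w i 0);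
  stochastic_euler_path : {ae P, forall w,
    euler_path f u0 (jump_time H ^~ w) (V ^~ w) (Vb ^~ w)} }.

(* For H i.i.d. exponential of rate h^-1, this is the homogeneous Poisson process
   of rate h^-1 whose jump times are the T_k, k >= 1. *)
Record jump_counting_process d (T : measurableType d) (R : realType)
    (P : probability T R) (H : nat -> {RV P >-> R}) (K : R -> T -> nat) :
    Prop := JumpCountingProcess {
  jump_counting_meas : forall t : R, 0 <= t -> measurable_fun setT (K t);
  jump_counting_path : {ae P, forall w, forall (t : R) (k : nat), 0 <= t ->
    (K t w = k <-> jump_time H k w <= t < jump_time H k.+1 w)} }.

(* Conditioning on an event of positive probability. *)
Definition conditional_expectation d (T : measurableType d) (R : realType)
    (P : probability T R) (X : T -> R) (E : set T) : \bar R :=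
  ((\int[P]_(w in E) (X w)%:E) / P E)%E.

(* Landau symbol for extended-real-valued functions: since [fine] maps the
   infinities to 0, finiteness near 0 has to be part of the claim. *)
Definition bigO_at_0 (R : realType) (F : R -> \bar R) (g : R -> R) : Prop :=
  (\forall e \near 0^'+, F e \is a fin_num) /\
  (fun e => fine (F e)) =O_ (0^'+) g.

(* Main.v *)
Require Import Defs.
From mathcomp Require Import all_boot all_order all_algebra ring lra.
From mathcomp Require Import all_classical all_reals all_analysis.
From mathcomp Require Import measurable_realfun.

Import Order.TTheory GRing.Theory Num.Theory.
Import numFieldNormedType.Exports.

Local Open Scope classical_set_scope.
Local Open Scope ring_scope.

(** The error is of order e^2 uniformly in the sample point: almost surely,
    whatever the jump times are, the squared error at every time e <= 1 is at
    most C e^4 with a deterministic constant C. Both claims follow by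
    integrating this bound, over the whole space or over the event K(e) = k, and
    taking square roots: a conditional mean inherits a deterministic bound
    whatever the probability of the event.

    For the pathwise bound, the exact solution and the numerical path are both
    compared with the first order expansion u0 + e A u0. Between jumps the path
    is affine with slope A applied to the frozen value, so that V(e) is reached
    from u0 by finitely many explicit Euler steps x -> x + s A x whose lengths s
    add up to e. The estimates collected in [euler_bounds] depend on the elapsed
    time only and are preserved by one such step of any length
    ([euler_bounds_step]), hence hold along the path ([euler_path_bounds]). For
    the exact solution, two applications of the mean value inequality
    [solves_on_deviation] give the same second order estimate
    ([linear_solution_expansion]).

    Randomness intervenes in two ways. Exponential variables are almost surely
    positive, so that the jump times increase; and K(e) being a natural number
    with T_K(e) <= e < T_(K(e)+1) says that only finitely many jumps occur
    before e. *)

(** * Sup norm estimates and the mean value inequality *)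

Lemma mx_norm_le {R : realType} {m n : nat} (x : 'M[R]_(m, n)) (c : R) :
  0 <= c -> (forall i j, `|x i j| <= c) -> `|x| <= c.
Proof.
move=> c0 xc; by rewrite [leLHS]mx_normrE; apply: bigmax_le.
Qed.

Lemma mx_entry_le_norm {R : realType} {m n : nat} (x : 'M[R]_(m, n)) i j :
  `|x i j| <= `|x|.
Proof.
by rewrite [leRHS]mx_normrE;
  apply: (le_bigmax _ (fun ij => `|x ij.1 ij.2|) (i, j)).
Qed.

(** A crude bound for the operator norm of A with respect to the sup norm; the
    O-estimates are insensitive to its size. *)
Definition entry_sum {R : realType} {d : nat} (A : 'M[R]_d) : R :=
  \sum_i \sum_j `|A i j|.

Lemma entry_sum_ge0 {R : realType} {d : nat} (A : 'M[R]_d) :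
  0 <= entry_sum A.
Proof. by do 2![apply: sumr_ge0 => ? _]. Qed.

Lemma norm_mulmx_le {R : realType} {d : nat} (A : 'M[R]_d) (x : 'cV[R]_d) :
  `|A *m x| <= entry_sum A * `|x|.
Proof.
apply: mx_norm_le => [|i j]; first by rewrite mulr_ge0 ?entry_sum_ge0.
rewrite mxE (le_trans (ler_norm_sum _ _ _))//.
apply: (@le_trans _ _ (\sum_k `|A i k| * `|x|)).
  by apply: ler_sum => k _; rewrite normrM ler_wpM2l ?mx_entry_le_norm.
rewrite -mulr_suml ler_wpM2r// [leRHS](bigD1 i)//= lerDl.
by do 2![apply: sumr_ge0 => ? _].
Qed.

(** Mean value inequality: a path whose derivative stays within M of a fixed
    slope m stays within M (t - s) of the line of slope m. The mean value
    theorem is applied to each coordinate, which the sup norm then collects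
    with no loss of constants. *)
Lemma solves_on_deviation {R : realType} {d : nat} (a : R) (b : itv_bound R)
    (y g : R -> 'cV[R]_d) (s t M : R) (m : 'cV[R]_d) :
  solves_on a b y g -> a <= s -> s <= t -> t \in Interval (BLeft a) b ->
  0 <= M -> (forall c, s <= c <= t -> `|g c - m| <= M) ->
  `|y t - y s - (t - s) *: m| <= M * (t - s).
Proof.
move=> [yc yd] as_ st tb M0 gM.
have ts0 : 0 <= t - s by rewrite subr_ge0.
apply: mx_norm_le => [|i j]; first by rewrite mulr_ge0.
have sub : [set` `[s, t]] `<=` [set` Interval (BLeft a) b].
  apply: subset_itv; first by rewrite bnd_simp.
  by move: tb; rewrite in_itv/= => /andP[_]; case: b {yc yd} => [[] x|[]].
have cont : {within `[s, t], continuous (fun r => y r i j)}.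
  apply: (@within_continuous_comp _ _ _ _ y (fun N : 'cV[R]_d => N i j)).
    by move=> z _; exact: coord_continuous.
  exact: continuous_subspaceW sub yc.
have der r : r \in `]s, t[ -> is_derive r 1 (fun r => y r i j) (g r i j).
  move=> /[!in_itv]/= /andP[sr rt].
  have /yd [dy <-] : r \in Interval (BRight a) b.
    rewrite in_itv/= (le_lt_trans as_ sr)/=.
    move: tb; rewrite in_itv/= => /andP[_].
    case: b {yc yd sub cont} => [[] x|[]]//=.
      exact: lt_trans.
    by move=> tx; apply: ltW; apply: lt_le_trans tx.
  apply: DeriveDef; first exact: (derivable_mxP _ _ _).1 dy i j.
  by rewrite derive_mx// mxE.
have [c cst E] := MVT_segment st der cont.
rewrite !mxE E (_ : _ - _ = (g c - m) i j * (t - s)); last first.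
  by rewrite !mxE; ring.
rewrite normrM (ger0_norm ts0) ler_wpM2r//.
by rewrite (le_trans (mx_entry_le_norm _ _ _))// gM// -in_itv.
Qed.

Lemma solves_on_bounded {R : realType} {d : nat} (a c : R)
    (y g : R -> 'cV[R]_d) : a <= c ->
  solves_on a +oo%O y g -> exists B, forall t, a <= t <= c -> `|y t| <= B.
Proof.
move=> ac [yc _].
have sub : [set` `[a, c]] `<=` [set` Interval (BLeft a) +oo%O].
  by apply: subset_itv; rewrite bnd_simp.
have [||r _ rB] := @compact_EVT_max _ R (fun r => `|y r|) `[a, c] _
  (@segment_compact _ a c).
- by exists a; rewrite /= in_itv/= lexx.
- apply: (@within_continuous_comp _ _ _ _ y (fun N : 'cV[R]_d => `|N|)).
    by move=> z _; exact: norm_continuous.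
  exact: continuous_subspaceW sub yc.
exists `|y r| => t tac; apply: rB; rewrite inE/= in_itv/=; exact: tac.
Qed.

(** * Explicit Euler steps *)

(** The invariant of a sequence of Euler steps started at u0, t being the sum of
    the step lengths: x is bounded, and close to its Taylor expansions of order
    zero and one, with constants that involve t but neither the number of steps
    nor their individual lengths. Each estimate feeds the next one in the
    induction over the steps. *)
Record euler_bounds {R : realType} {d : nat} (A : 'M[R]_d) (u0 : 'cV[R]_d)
    (t : R) (x : 'cV[R]_d) : Prop := EulerBounds {
  euler_bounds_time : 0 <= t;
  euler_bounds0 : `|x| <= expR (entry_sum A * t) * `|u0|;
  euler_bounds1 :
    `|x - u0| <= entry_sum A * (expR (entry_sum A * t) * `|u0|) * t;
  euler_bounds2 :
    `|x - u0 - t *: (A *m u0)| <=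
      entry_sum A ^+ 2 * (expR (entry_sum A * t) * `|u0|) * t ^+ 2 }.

Lemma euler_bounds_init {R : realType} {d : nat} (A : 'M[R]_d) (u0 : 'cV[R]_d) :
  euler_bounds A u0 0 u0.
Proof.
split=> //; first by rewrite mulr0 expR0 mul1r.
  by rewrite subrr normr0 mulr0.
by rewrite subrr scale0r subrr normr0 expr0n/= mulr0.
Qed.

(** With L = entry_sum A, a step multiplies the norm by at most
    1 + L s <= exp (L s). It adds s A x to x - u0, bounded by the first estimate,
    and s A (x - u0) to the second order defect, bounded by the second one; the
    latter adds a multiple of s t, and t^2 + s t <= (t + s)^2. *)
Lemma euler_bounds_step {R : realType} {d : nat} (A : 'M[R]_d)
    (u0 : 'cV[R]_d) (t s : R) (x : 'cV[R]_d) :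
  0 <= s -> euler_bounds A u0 t x ->
  euler_bounds A u0 (t + s) (x + s *: (A *m x)).
Proof.
move=> s0 [t0 b0 b1 b2]; set L := entry_sum A in b0 b1 b2 *.
have L0 : 0 <= L := entry_sum_ge0 A.
set E := expR (L * t) * `|u0| in b0 b1 b2.
have E0 : 0 <= E by rewrite mulr_ge0 ?expR_ge0.
set E' := expR (L * (t + s)) * `|u0|.
have EE' : E <= E'.
  by rewrite ler_wpM2r// ler_expR ler_wpM2l// lerDl.
have grow : E + s * (L * E) <= E'.
  rewrite (_ : E + _ = (1 + L * s) * E); last by ring.
  rewrite /E' mulrDr expRD [_ * expR (L * s)]mulrC -mulrA ler_wpM2r//.
  exact: expR_ge1Dx.
have Ab0 : `|s *: (A *m x)| <= s * (L * E).
  rewrite normrZ ger0_norm// ler_wpM2l// (le_trans (norm_mulmx_le _ _))//.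
  by rewrite ler_wpM2l.
split; first exact: addr_ge0.
- by rewrite -/L -/E' (le_trans (ler_normD _ _))// (le_trans _ grow)// lerD.
- rewrite -/L -/E' addrAC (le_trans (ler_normD _ _))//.
  apply: (@le_trans _ _ (L * E * (t + s))).
    by rewrite mulrDr lerD// (le_trans Ab0)// mulrC.
  by rewrite ler_wpM2r ?addr_ge0// ler_wpM2l.
- rewrite -/L -/E'.
  have -> : x + s *: (A *m x) - u0 - (t + s) *: (A *m u0) =
      (x - u0 - t *: (A *m u0)) + s *: (A *m (x - u0)).
    rewrite mulmxBr scalerBr scalerDl.
    by apply/matrixP => i j; rewrite !mxE; ring.
  rewrite (le_trans (ler_normD _ _))//.
  have b3 : `|s *: (A *m (x - u0))| <= s * (L * (L * E * t)).
    rewrite normrZ ger0_norm// ler_wpM2l// (le_trans (norm_mulmx_le _ _))//.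
    by rewrite ler_wpM2l.
  rewrite (le_trans (lerD b2 b3))//.
  apply: (@le_trans _ _ (L ^+ 2 * E * (t + s) ^+ 2)).
    rewrite (_ : _ + _ = L ^+ 2 * E * (t ^+ 2 + s * t)); last by ring.
    rewrite ler_wpM2l ?mulr_ge0 ?sqr_ge0//; nra.
  by rewrite ler_wpM2r ?sqr_ge0// ler_wpM2l ?sqr_ge0.
Qed.

(** * Paths of the Euler dynamics *)

Lemma jump_timeS {R : realType} {T : Type} (H : nat -> T -> R) k w :
  jump_time H k.+1 w = jump_time H k w + H k w.
Proof. by rewrite /jump_time big_ord_recr. Qed.

Lemma jump_time0 {R : realType} {T : Type} (H : nat -> T -> R) w :
  jump_time H 0 w = 0.
Proof. by rewrite /jump_time big_ord0. Qed.

(** The second component has zero derivative on the interval and is therefore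
    frozen, which makes the derivative of the first component constant; the
    mean value inequality with zero tolerance turns both facts into
    equalities. *)
Lemma euler_path_affine {R : realType} {d : nat} (f : 'cV[R]_d -> 'cV[R]_d)
    (u0 : 'cV[R]_d) (tau : nat -> R) (v vb : R -> 'cV[R]_d) (k : nat) (t : R) :
  euler_path f u0 tau v vb -> tau k <= t < tau k.+1 ->
  v t = v (tau k) + (t - tau k) *: f (vb (tau k)).
Proof.
move=> [_ /(_ k)[fv fvb] _] /andP[kt tk].
have vbE c : tau k <= c <= t -> vb c = vb (tau k).
  move=> /andP[kc ct].
  have ck : c \in Interval (BLeft (tau k)) (BLeft (tau k.+1)).
    by rewrite in_itv/= kc (le_lt_trans ct).
  have : `|vb c - vb (tau k) - (c - tau k) *: 0| <= 0 * (c - tau k).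
    apply: (solves_on_deviation _ _ _ _ _ _ _ _ fvb) => // r _.
    by rewrite subrr normr0.
  by rewrite mul0r scaler0 subr0 normr_le0 subr_eq0 => /eqP.
have tin : t \in Interval (BLeft (tau k)) (BLeft (tau k.+1)).
  by rewrite in_itv/= kt tk.
have : `|v t - v (tau k) - (t - tau k) *: f (vb (tau k))| <= 0 * (t - tau k).
  apply: (solves_on_deviation _ _ _ _ _ _ _ _ fv) => // c /vbE ->.
  by rewrite subrr normr0.
by rewrite mul0r normr_le0 subr_eq0 subr_eq addrC => /eqP.
Qed.

(** The affine formula extends to the right end point, where the new interval
    starts, because the path has no jump in its first component. *)
Lemma euler_path_jump_value {R : realType} {d : nat} (f : 'cV[R]_d -> 'cV[R]_d)
    (u0 : 'cV[R]_d) (tau : nat -> R) (v vb : R -> 'cV[R]_d) (k : nat) :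
  euler_path f u0 tau v vb -> tau k < tau k.+1 ->
  v (tau k.+1) = v (tau k) + (tau k.+1 - tau k) *: f (vb (tau k)).
Proof.
move=> pth kk; have [_ _ /(_ k)[vl _]] := pth.
have lim : v t @[t --> (tau k.+1)^'-] -->
    v (tau k) + (tau k.+1 - tau k) *: f (vb (tau k)).
  apply: (@cvg_trans _ ((v (tau k) + (t - tau k) *: f (vb (tau k)))
      @[t --> (tau k.+1)^'-])).
    apply: near_eq_cvg; near=> t.
    apply/esym/(euler_path_affine _ _ _ _ _ _ _ pth).
    apply/andP; split; last by near: t; exact: nbhs_left_lt.
    by near: t; exact: nbhs_left_ge.
  apply: cvgD; first exact: cvg_cst.
  apply: cvgZr_tmp.
  apply: cvgB; last exact: cvg_cst.
  exact: cvg_at_left_filter.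
exact: cvg_unique vl lim.
Unshelve. all: end_near. Qed.

(** At every jump time the two components agree, so each interval between jumps
    performs one explicit Euler step from the common value, and the part of the
    current interval before t is one more, shorter, step. *)
Lemma euler_path_bounds {R : realType} {d : nat} (A : 'M[R]_d)
    (u0 : 'cV[R]_d) (tau : nat -> R) (v vb : R -> 'cV[R]_d) (k : nat) (t : R) :
  euler_path (fun x => A *m x) u0 tau v vb -> tau 0%N = 0 ->
  (forall j, tau j < tau j.+1) -> tau k <= t < tau k.+1 ->
  euler_bounds A u0 t (v t).
Proof.
move=> pth tau0 tauS ktk.
have vvb j : v (tau j) = vb (tau j).
  case: j => [|j]; first by rewrite tau0; have [[-> ->] _ _] := pth.
  by have [_ _ /(_ j)[vl vbl]] := pth; exact: cvg_unique vl vbl.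
have bnd j : euler_bounds A u0 (tau j) (v (tau j)).
  elim: j => [|j IH].
    by rewrite tau0; have [[-> _] _ _] := pth; exact: euler_bounds_init.
  rewrite (euler_path_jump_value _ _ _ _ _ _ pth)// -vvb.
  rewrite -{1}(subrKC (tau j) (tau j.+1)).
  by apply: euler_bounds_step => //; rewrite subr_ge0 ltW.
rewrite (euler_path_affine _ _ _ _ _ _ _ pth ktk) -vvb.
rewrite -{1}(subrKC (tau k) t).
by apply: euler_bounds_step => //; rewrite subr_ge0; case/andP: ktk.
Qed.

(** * The exact solution *)

(** The mean value inequality is used twice: with slope zero, to see that the
    solution moves by at most a multiple of t, and then with slope A u(0), the
    derivative A u(t) having moved by at most a multiple of t. *)
Lemma linear_solution_expansion {R : realType} {d : nat} (A : 'M[R]_d)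
    (u : R -> 'cV[R]_d) (B e : R) :
  solves_on 0 +oo%O u (fun t => A *m u t) -> 0 <= e ->
  (forall t, 0 <= t <= e -> `|u t| <= B) ->
  `|u e - u 0 - e *: (A *m u 0)| <= entry_sum A ^+ 2 * B * e ^+ 2.
Proof.
move=> su e0 uB; set L := entry_sum A; have L0 : 0 <= L := entry_sum_ge0 A.
have B0 : 0 <= B by rewrite (le_trans _ (uB 0 _))// lexx.
have bnd1 t : 0 <= t <= e -> `|u t - u 0| <= L * B * t.
  move=> /andP[t0 te].
  have := solves_on_deviation _ _ _ _ _ t (L * B) 0 su (lexx 0) t0.
  rewrite scaler0 !subr0; apply; first by rewrite in_itv/= t0.
    exact: mulr_ge0.
  move=> c /andP[c0 ct]; rewrite subr0 (le_trans (norm_mulmx_le _ _))//.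
  by rewrite ler_wpM2l// uB// c0 (le_trans ct).
have := solves_on_deviation _ _ _ _ _ e (L * (L * B * e)) (A *m u 0)
  su (lexx 0) e0.
rewrite !subr0 (_ : L * (L * B * e) * e = L ^+ 2 * B * e ^+ 2); last by ring.
apply; first by rewrite in_itv/= e0.
  by rewrite !mulr_ge0.
move=> c /andP[c0 ce]; rewrite -mulmxBr (le_trans (norm_mulmx_le _ _))//.
rewrite ler_wpM2l// (le_trans (bnd1 _ _)) ?c0//.
by rewrite ler_wpM2l// mulr_ge0.
Qed.

(** * From pointwise bounds to Landau symbols *)

Lemma euclidean_norm_sqr {R : realType} {d : nat} (x : 'cV[R]_d) :
  euclidean_norm x ^+ 2 = \sum_(i < d) x i 0 ^+ 2.
Proof. by rewrite sqr_sqrtr// sumr_ge0// => i _; exact: sqr_ge0. Qed.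

Lemma euclidean_norm_sqr_le {R : realType} {d : nat} (x : 'cV[R]_d) :
  euclidean_norm x ^+ 2 <= d%:R * `|x| ^+ 2.
Proof.
rewrite euclidean_norm_sqr -[X in X%:R]card_ord mulr_natl -sumr_const.
apply: ler_sum => i _; rewrite -real_normK ?num_real// lerXn2r ?nnegrE//.
exact: mx_entry_le_norm.
Qed.

Lemma measurable_euclidean_norm_sqr {disp} {T : measurableType disp}
    {R : realType} {d : nat} (D : set T) (W : T -> 'cV[R]_d) :
  (forall i, measurable_fun D (fun w => W w i 0)) ->
  measurable_fun D (fun w => euclidean_norm (W w) ^+ 2).
Proof.
move=> mW; rewrite (_ : (fun w => _) = fun w => \sum_(i < d) W w i 0 ^+ 2).
  by apply: measurable_sum => i; exact: measurable_funX.
by apply/funext => w; exact: euclidean_norm_sqr.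
Qed.

(** The density vanishes to the left of 0, and the point 0 is a Lebesgue null
    set. *)
Lemma exponential_law_gt0 {disp} {T : measurableType disp} {R : realType}
    {P : probability T R} (rate : R) (X : {RV P >-> R}) :
  has_exponential_law rate X -> {ae P, forall w, 0 < X w}.
Proof.
move=> /(_ `]-oo, (0:R)]%classic (measurable_itv _)) EX.
exists (X @^-1` `]-oo, (0:R)]%classic); split.
- by rewrite -[X in measurable X]setTI; exact: measurable_funPT.
- change (distribution P X `]-oo, (0:R)]%classic = 0%E); rewrite EX.
  rewrite /exponential_prob -integral_itv_bndo_bndc//; last first.
    apply/measurable_EFinP; apply: measurable_funTS.
    exact: measurable_exponential_pdf.
  rewrite (eq_integral (cst 0%E)) ?integral0// => x.
  by rewrite inE/= in_itv/= => x0; rewrite lt0_exponential_pdf.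
- move=> w /= /negP; rewrite -leNgt in_itv/=; exact.
Qed.

(** Finiteness near 0, which the Landau claim includes, comes from the same
    upper bound as the rate. *)
Lemma bigO_at_0_sqrt {R : realType} (Y : R -> \bar R) (C : R) :
  (forall e, 0 < e <= 1 -> (0 <= Y e <= (C * e ^+ 4)%:E)%E) ->
  bigO_at_0 (fun e => (Y e `^ 2^-1)%E) (fun e => e ^+ 2).
Proof.
move=> YC.
have fin e : 0 < e <= 1 -> Y e \is a fin_num.
  move=> /YC /andP[Y0 YCe]; rewrite ge0_fin_numE//.
  exact: le_lt_trans YCe (ltry _).
have near01 : \forall e \near (0:R)^'+, 0 < e <= 1.
  near=> e; apply/andP; split; first by near: e; exact: nbhs_right_gt.
  by near: e; exact: nbhs_right_le.
split.
  by apply: filterS near01 => e /fin; exact: fin_num_poweR.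
apply/eqO_exP; exists (Num.sqrt C + 1); first by rewrite ltr_wpDl ?sqrtr_ge0.
apply: filterS near01 => e e01; have /andP[e0 _] := e01.
have /andP[] := YC e e01; rewrite -(fineK (fin e e01)) !lee_fin => Y0 YCe.
rewrite /= powR12_sqrt// !ger0_norm ?sqrtr_ge0 ?sqr_ge0//.
apply: (@le_trans _ _ (Num.sqrt C * e ^+ 2)); last first.
  by rewrite ler_wpM2r ?sqr_ge0// lerDl.
rewrite -[X in _ * X]ger0_norm ?sqr_ge0// -sqrtr_sqr -exprM.
have C0 : 0 <= C.
  by rewrite -(@pmulr_lge0 _ (e ^+ 4)) ?exprn_gt0//; exact: le_trans Y0 YCe.
by rewrite -sqrtrM// ler_wsqrtr.
Unshelve. all: end_near. Qed.

Lemma integral_le_ae_bound {disp} {T : measurableType disp} {R : realType}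
    (P : probability T R) (X : T -> R) (D : set T) (c : R) :
  measurable D -> measurable_fun setT X -> (forall w, 0 <= X w) -> 0 <= c ->
  {ae P, forall w, X w <= c} ->
  (0 <= \int[P]_(w in D) (X w)%:E <= c%:E * P D)%E.
Proof.
move=> mD mX X0 c0 Xc; apply/andP; split.
  by apply: integral_ge0 => w _; rewrite lee_fin.
rewrite -integral_cst//; apply: ae_ge0_le_integral => //.
- by move=> w _; rewrite lee_fin.
- by apply: measurable_funTS; apply/measurable_EFinP.
- by apply: filterS Xc => w Xc _; rewrite lee_fin.
Qed.

Lemma conditional_expectation_le_ae_bound {disp} {T : measurableType disp}
    {R : realType} (P : probability T R) (X : T -> R) (D : set T) (c : R) :
  measurable D -> measurable_fun setT X -> (forall w, 0 <= X w) -> 0 <= c ->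
  {ae P, forall w, X w <= c} ->
  (0 <= conditional_expectation P X D <= c%:E)%E.
Proof.
move=> mD mX X0 c0 Xc.
have /andP[I0 Ic] := integral_le_ae_bound P X D c mD mX X0 c0 Xc.
rewrite /conditional_expectation; have [PD0|PD0] := eqVneq (P D) 0%E.
  (* On a null event the quotient is 0 * +oo, which is 0. *)
  have -> : (\int[P]_(w in D) (X w)%:E = 0)%E.
    by apply/le_anti; rewrite I0 (le_trans Ic)// PD0 mule0.
  by rewrite mul0e lexx lee_fin.
have PDgt0 : (0 < P D)%E by rewrite lt0e PD0 measure_ge0.
have PDfin : P D \is a fin_num by exact: fin_num_measure.
apply/andP; split; first by rewrite mule_ge0// inve_ge0.
have p0 : 0 < fine (P D) by rewrite fine_gt0// PDgt0 -ge0_fin_numE.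
by rewrite -(fineK PDfin) inver gt_eqF// lee_pdivrMr// fineK.
Qed.

(** * Almost sure error bound *)

(** Both x and u(e) are within a multiple of e^2 of u0 + e A u0. The constants
    become uniform in e on [0, 1] by monotonicity of the exponential for the
    first and by compactness for the second. *)
Lemma euler_error_pathwise {R : realType} {d : nat} (A : 'M[R]_d)
    (u0 : 'cV[R]_d) (u : R -> 'cV[R]_d) :
  u 0 = u0 -> solves_on 0 +oo%O u (fun t => A *m u t) ->
  exists2 C : R, 0 <= C & forall (e : R) (x : 'cV[R]_d),
    e <= 1 -> euler_bounds A u0 e x ->
    euclidean_norm (x - u e) ^+ 2 <= C * e ^+ 4.
Proof.
move=> u00 su; have [B uB] := solves_on_bounded _ _ _ _ (@ler01 R) su.
set L := entry_sum A; pose D := L ^+ 2 * (expR L * `|u0|) + L ^+ 2 * B.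
exists (d%:R * D ^+ 2); first by rewrite mulr_ge0// sqr_ge0.
move=> e x e1 [e0 _ _ bx].
have L0 : 0 <= L := entry_sum_ge0 A.
have bu : `|u e - u 0 - e *: (A *m u 0)| <= L ^+ 2 * B * e ^+ 2.
  apply: linear_solution_expansion => // t /andP[t0 te].
  by rewrite uB// t0 (le_trans te).
have E : `|x - u e| <= D * e ^+ 2.
  have -> : x - u e = (x - u0 - e *: (A *m u0)) - (u e - u 0 - e *: (A *m u 0)).
    by rewrite u00; apply/matrixP => i j; rewrite !mxE; ring.
  rewrite (le_trans (ler_normB _ _))// mulrDl lerD// (le_trans bx)//.
  rewrite ler_wpM2r ?sqr_ge0// ler_wpM2l ?sqr_ge0// ler_wpM2r// ler_expR.
  by rewrite ler_piMr.
rewrite (le_trans (euclidean_norm_sqr_le _))// -mulrA ler_wpM2l//.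
rewrite (_ : D ^+ 2 * _ = (D * e ^+ 2) ^+ 2); last by ring.
by rewrite lerXn2r// nnegrE// (le_trans _ E).
Qed.

(** A single null event serves all times e: off it, the jump times increase and
    K(e) locates e between two of them. *)
Lemma stochastic_euler_path_bounds {disp} {T : measurableType disp}
    {R : realType} {P : probability T R} {d : nat} (A : 'M[R]_d)
    (u0 : 'cV[R]_d) (h : R) (H : nat -> {RV P >-> R})
    (V Vb : R -> T -> 'cV[R]_d) (K : R -> T -> nat) :
  stochastic_euler (fun x => A *m x) h u0 H V Vb ->
  jump_counting_process H K ->
  {ae P, forall w, forall e, 0 <= e -> euler_bounds A u0 e (V e w)}.
Proof.
move=> [_ Hexp _ pathV] [_ pathK].
have Hpos : {ae P, forall w, forall k, 0 < H k w}.
  by apply/ae_foralln => k; exact: exponential_law_gt0 (Hexp k).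
apply: filterS3 pathV pathK Hpos => w pV pK pH e e0.
apply: (euler_path_bounds _ _ _ _ _ (K e w) _ pV).
- exact: jump_time0.
- by move=> j; rewrite jump_timeS ltrDl.
- exact/(pK e (K e w) e0).
Qed.

Theorem theorem3p6 (R : realType) (disp : measure_display)
    (T : measurableType disp) (P : probability T R)
    (d : nat) (A : 'M[R]_d) (u0 : 'cV[R]_d) (h : R) (hpos : 0 < h)
    (u : R -> 'cV[R]_d)
    (hu0 : u 0 = u0)
    (hu : solves_on 0 +oo%O u (fun t => A *m u t))
    (H : nat -> {RV P >-> R})
    (V Vb : R -> T -> 'cV[R]_d)
    (hV : stochastic_euler (fun x => A *m x) h u0 H V Vb)
    (K : R -> T -> nat)
    (hK : jump_counting_process H K) :
  (forall k : nat,
     bigO_at_0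
       (fun e => (conditional_expectation P
          (fun w => (euclidean_norm (V e w - u e) ^+ 2)%R)
          [set w | K e w = k] `^ 2^-1)%E)
       (fun e => e ^+ 2)) /\
  bigO_at_0
    (fun e => ('E_P[fun w => (euclidean_norm (V e w - u e) ^+ 2)%R] `^ 2^-1)%E)
    (fun e => e ^+ 2).
Proof.
have [C C0 errC] := euler_error_pathwise A u0 u hu0 hu.
have Ce4 e : 0 <= C * e ^+ 4 by rewrite mulr_ge0// exprn_even_ge0.
have errV e : 0 < e <= 1 ->
    {ae P, forall w, euclidean_norm (V e w - u e) ^+ 2 <= C * e ^+ 4}.
  move=> /andP[e0 e1].
  apply: filterS (stochastic_euler_path_bounds _ _ _ _ _ _ _ hV hK) => w bV.
  by apply: errC => //; apply: bV; exact: ltW.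
have mV e : 0 < e <= 1 ->
    measurable_fun setT (fun w => euclidean_norm (V e w - u e) ^+ 2).
  move=> /andP[e0 _]; apply: measurable_euclidean_norm_sqr => i.
  rewrite (_ : (fun w => _) = (fun w => V e w i 0) \- cst (u e i 0)).
    apply: measurable_funB; last exact: measurable_cst.
    by have [] := stochastic_euler_meas hV i (ltW e0).
  by apply/funext => w; rewrite !mxE.
split=> [k|]; apply: (bigO_at_0_sqrt _ C) => e e01.
  apply: conditional_expectation_le_ae_bound => //.
  - have /andP[e0 _] := e01; rewrite -[X in measurable X]setTI.
    have mk : measurable [set k] by [].
    exact: (jump_counting_meas hK (ltW e0) measurableT mk).
  - exact: mV.
  - by move=> w; exact: sqr_ge0.
  - exact: errV.
rewrite unlock -[X in (_ <= _ <= X)%E]mule1 -(probability_setT P).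
apply: integral_le_ae_bound => //; [exact: mV| |exact: errV].
by move=> w; exact: sqr_ge0.
Qed.
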